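(* For $j=1,2$, let $\mathcal H_j$ be any complex Hilbert space, $(\Sigma_j,\mathcal M_j,\mu_j)$ any $\sigma$-finite measure space, and $\pi_j\in\mathrm{SQ}(\mathbb B(\mathcal H_j),\mu_j)$. Define $$\pi_1\otimes\pi_2:\Sigma_1\times\Sigma_2\to\mathbb B(\mathcal H_1\widehat\otimes\mathcal H_2),\qquad(\pi_1\otimes\pi_2)(s_1,s_2):=\pi_1(s_1)\otimes\pi_2(s_2).$$ Then $\pi_1\otimes\pi_2\in\mathrm{SQ}(\mathbb B(\mathcal H_1\widehat\otimes\mathcal H_2),\mu_1\otimes\mu_2)$.
   Context: $\widehat\otimes$ denotes the Hilbert space tensor product and $\mu_1\otimes\mu_2$ the product measure. Inner products are linear in the first variable and antilinear in the second. For a complex Hilbert space $\mathcal H$ and a measure space $(\Sigma,\mathcal M,\mu)$ ($\mu$ a positive measure), $\mathrm{SQ}(\mathbb B(\mathcal H),\mu)$ denotes the set of all almost everywhere defined, weakly measurable maps $\pi:\Sigma\to\mathbb B(\mathcal H)$ (i.e. $s\mapsto\langle\pi(s)u,v\rangle$ is measurable for all $u,v\in\mathcal H$) such that $$\int_\Sigma\langle\pi(s)u_1,v_1\rangle\langle v_2,\pi(s)u_2\rangle\,d\mu(s)=\langle u_1,u_2\rangle\langle v_2,v_1\rangle\quad\text{for all }u_1,u_2,v_1,v_2\in\mathcal H.$$ *)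

(* Defs.v *)
From HB Require Import structures.
From mathcomp Require Import all_boot all_order all_algebra sesquilinear.
From mathcomp Require Import complex.
From mathcomp Require Import all_classical all_reals all_analysis.

Set Implicit Arguments.
Unset Strict Implicit.
Unset Printing Implicit Defensive.

Import Order.TTheory GRing.Theory Num.Theory.
Import numFieldNormedType.Exports.

Local Open Scope classical_set_scope.
Local Open Scope ring_scope.

(* Complex Hilbert spaces.  A form in [{dot H for Num.conj}] is linear in its
   first argument and antilinear in its second one. *)
HB.mixin Record NormedModule_isHilbert (R : realType) (H : Type)
    of NormedModule R[i] H := {
  inner : {dot H for @Num.conj R[i]} ;
  sqr_norm_inner : forall x : H, `|x| ^+ 2 = inner x x
}.

#[short(type="hilbertType")]
HB.structure Definition Hilbert (R : realType) :=
  {H of NormedModule_isHilbert R H & CompleteNormedModule R[i] H}.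

Notation "''[' u , v ]" := (inner u v) : ring_scope.

Section bounded_operators.
Context {R : realType}.

Record bop (H : hilbertType R) := Bop {
  bop_fun :> {linear H -> H} ;
  bop_bounded : bounded_near bop_fun (nbhs (0 : H))
}.

HB.instance Definition _ (H : hilbertType R) := gen_eqMixin (bop H).
HB.instance Definition _ (H : hilbertType R) := gen_choiceMixin (bop H).

Lemma bop0_bounded (H : hilbertType R) :
  bounded_near (\0 : {linear H -> H}) (nbhs (0 : H)).
Proof. by apply/linear_bounded_continuous => x; exact: cvg_cst. Qed.

Definition bop0 (H : hilbertType R) : bop H := Bop (@bop0_bounded H).

HB.instance Definition _ (H : hilbertType R) := isPointed.Build (bop H) (bop0 H).

End bounded_operators.

Section hilbert_tensor_product.
Context {R : realType}.

(* [H], together with the map (u, v) |-> u (x) v, is the Hilbert space tensor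
   product of [H1] and [H2].  These conditions determine [H] up to a unique
   unitary map compatible with elementary tensors. *)
Record hilbert_tensor (H1 H2 H : hilbertType R) := HilbertTensor {
  tens :> {bilinear H1 -> H2 -> H} ;
  inner_tens : forall (u1 u2 : H1) (v1 v2 : H2),
    '[tens u1 v1, tens u2 v2] = '[u1, u2] * '[v1, v2] ;
  dense_tens : dense [set x : H | exists n (u : 'I_n -> H1) (v : 'I_n -> H2),
    x = \sum_(i < n) tens (u i) (v i)]
}.

Context {H1 H2 H : hilbertType R} (t : hilbert_tensor H1 H2 H).

(* The operator A (x) B: the bounded operator on [H] mapping u (x) v to
   A u (x) B v.  It is unique by [dense_tens] and exists for all [A] and [B],
   so that the default value of [get] is never used. *)
Definition tensor_op (A : bop H1) (B : bop H2) : bop H :=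
  get [set C : bop H | forall u v, C (t u v) = t (A u) (B v)].

(* Partially defined maps are [option]-valued; the tensor product of two such
   maps is defined at (s1, s2) iff both factors are defined. *)
Definition tensor_map (S1 S2 : Type) (pi1 : S1 -> option (bop H1))
    (pi2 : S2 -> option (bop H2)) (s : S1 * S2) : option (bop H) :=
  if (pi1 s.1, pi2 s.2) is (Some A, Some B) then Some (tensor_op A B) else None.

End hilbert_tensor_product.

Section complex_valued_functions.
Context d (T : measurableType d) (R : realType).
Implicit Types (mu : {measure set T -> \bar R}) (D : set T) (f : T -> R[i]).

Definition cmeasurable_fun D f :=
  measurable_fun D (fun s => complex.Re (f s)) /\
  measurable_fun D (fun s => complex.Im (f s)).

Definition cintegrable mu D f :=
  mu.-integrable D (fun s => (complex.Re (f s))%:E) /\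
  mu.-integrable D (fun s => (complex.Im (f s))%:E).

Definition cintegral mu D f : R[i] :=
  ((\int[mu]_(s in D) complex.Re (f s)) +i*
   (\int[mu]_(s in D) complex.Im (f s)))%C.

End complex_valued_functions.

Section square_integrable_maps.
Context d (S : measurableType d) (R : realType) (H : hilbertType R).

Definition domain (pi : S -> option (bop H)) : set S := [set s | isSome (pi s)].

(* The default value 0 of [oapp] is irrelevant: measurability and integrals are
   taken on the domain of [pi]. *)
Definition coef (pi : S -> option (bop H)) (u v : H) (s : S) : R[i] :=
  oapp (fun A : bop H => '[A u, v]) 0 (pi s).

Definition coef2 (pi : S -> option (bop H)) (u1 v1 u2 v2 : H) (s : S) : R[i] :=
  oapp (fun A : bop H => '[A u1, v1] * '[v2, A u2]) 0 (pi s).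

(* The set SQ(B(H), mu).  [measurable_fun D f] only constrains [f] when [D] is
   measurable, hence the explicit first condition. *)
Definition SQ (mu : {measure set S -> \bar R}) : set (S -> option (bop H)) :=
  [set pi | [/\ measurable (domain pi),
    mu (~` domain pi) = 0%E,
    forall u v, cmeasurable_fun (domain pi) (coef pi u v) &
    forall u1 u2 v1 v2,
      cintegrable mu (domain pi) (coef2 pi u1 v1 u2 v2) /\
      cintegral mu (domain pi) (coef2 pi u1 v1 u2 v2) =
        '[u1, u2] * '[v2, v1]]].

End square_integrable_maps.

Arguments SQ {d S R} H mu.

(* Main.v *)
Require Import Defs.
From HB Require Import structures.
From mathcomp Require Import all_boot all_order all_algebra sesquilinear.
From mathcomp Require Import complex.
From mathcomp Require Import all_classical all_reals all_analysis.
From mathcomp Require Import measurable_realfun ring lra.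

Set Implicit Arguments.
Unset Strict Implicit.
Unset Printing Implicit Defensive.

Import Order.TTheory GRing.Theory Num.Theory.
Import numFieldNormedType.Exports.

Local Open Scope classical_set_scope.
Local Open Scope ring_scope.

(** Three facts carry the proof.

    The operator A (x) B exists on H ([tensor_opE]).  On finite sums of
    elementary tensors the estimate
    |sum A u_i (x) B v_i| <= c |sum u_i (x) v_i| says that two double sums
    of products of Gram entries compare.  Replacing one operator at a time, it
    says that the sum of k(u_i, u_j) <v_i, v_j> is nonnegative for the
    positive form k(x, y) = M^2 <x, y> - <A x, A y>; this is a form of the
    Schur product theorem ([sum_form_inner_ge0]).  A bounded linear relation
    with dense domain extends to a bounded operator ([bounded_extension]).

    For elementary tensors the coefficients of the tensor product factor, so
    their integrals are products by Fubini's theorem ([has_cintegral_tensor]),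
    and both sides of the required identity are additive in each of the four
    vectors.  Hence the identity holds for finite sums of elementary tensors,
    which form a dense set E.

    It passes from E to all of H ([SQ_dense]).  Coefficients are pointwise
    limits of coefficients at vectors of E, hence measurable.  By Fatou's lemma
    the squared modulus of <pi u, v> has integral at most a constant depending
    on |u| and |v| only, so the integrals in the identity converge and are
    bounded on bounded sets.  The difference of the two sides is therefore, in
    each vector separately, an additive function which is bounded on the unit
    ball; such a function vanishes as soon as it vanishes on a dense set
    ([additive_bounded_dense_eq0]). *)

(** * Inner products and dense sets *)

Section inner_product.
Context {R : realType} {H : hilbertType R}.
Implicit Types (u v w : H) (a : R[i]).

Lemma innerDl u v w : '[u + v, w] = '[u, w] + '[v, w].
Proof. exact: linearDl. Qed.

Lemma innerDr u v w : '[w, u + v] = '[w, u] + '[w, v].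
Proof. exact: linearDr. Qed.

Lemma innerBl u v w : '[u - v, w] = '[u, w] - '[v, w].
Proof. exact: linearBl. Qed.

Lemma innerBr u v w : '[w, u - v] = '[w, u] - '[w, v].
Proof. exact: linearBr. Qed.

Lemma innerZl a u v : '[a *: u, v] = a * '[u, v].
Proof. exact: linearZl_LR. Qed.

Lemma innerZr a u v : '[u, a *: v] = Num.conj a * '[u, v].
Proof. exact: linearZr_LR. Qed.

Lemma inner0l v : '[0, v] = 0 :> R[i].
Proof. exact: linear0l. Qed.

Lemma innerC u v : '[u, v] = Num.conj '[v, u].
Proof. by rewrite hermC expr0 mul1r. Qed.

Lemma inner_suml I (r : seq I) (f : I -> H) v :
  '[\sum_(i <- r) f i, v] = \sum_(i <- r) '[f i, v].
Proof. exact: (linear_sumlz inner). Qed.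

Lemma inner_sumr I (r : seq I) (f : I -> H) v :
  '[v, \sum_(i <- r) f i] = \sum_(i <- r) '[v, f i].
Proof. exact: (linear_sumr inner). Qed.

Lemma inner_sum I J (r : seq I) (q : seq J) (x : I -> H) (y : J -> H) :
  '[\sum_(i <- r) x i, \sum_(j <- q) y j] =
  \sum_(i <- r) \sum_(j <- q) '[x i, y j].
Proof. by rewrite inner_suml; apply: eq_bigr => i _; rewrite inner_sumr. Qed.

Lemma inner_ge0 u : 0 <= '[u, u] :> R[i].
Proof. exact: dnorm_ge0. Qed.

Lemma inner_le_norm u v : `|'[u, v]| <= `|u| * `|v|.
Proof.
rewrite -(@ler_pXn2r _ 2) ?nnegrE ?mulr_ge0 ?normr_ge0// exprMn.
rewrite !sqr_norm_inner.
have [->|v0] := eqVneq v 0.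
  by rewrite linear0r normr0 expr0n/= mulr_ge0 ?inner_ge0.
have vv : 0 < '[v, v] :> R[i] by rewrite dnorm_gt0.
have vv0 := lt0r_neq0 vv.
have vvC : Num.conj ('[v, v] : R[i]) = '[v, v] by rewrite -innerC.
pose a := '[u, v] / '[v, v].
(* [a *: v] is the orthogonal projection of [u] on the line of [v]. *)
have := inner_ge0 (u - a *: v).
rewrite innerBl !innerBr innerZl innerZr innerZl innerZr.
have -> : Num.conj a * ('[u, v] : R[i]) = `|'[u, v]| ^+ 2 / '[v, v].
  by rewrite /a rmorphM fmorphV/= vvC normCK mulrC mulrA.
have -> : a * ('[v, u] : R[i]) = `|'[u, v]| ^+ 2 / '[v, v].
  by rewrite /a [in X in _ * X]innerC normCK mulrAC.
have -> : a * (Num.conj a * '[v, v]) = `|'[u, v]| ^+ 2 / '[v, v].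
  by rewrite /a rmorphM fmorphV/= vvC mulfVK// normCK mulrAC.
by rewrite subrr subr0 subr_ge0 ler_pdivrMr.
Qed.

End inner_product.

Section bounded_operator_theory.
Context {R : realType} {H : hilbertType R}.

Lemma bop_norm_le (A : bop H) :
  exists2 M : R[i], 0 < M & forall x, `|A x| <= M * `|x|.
Proof.
have /linear_boundedP := bop_bounded A.
by move=> /pinfty_ex_gt0[M M0 AM]; exists M.
Qed.


End bounded_operator_theory.

Section dense_sets.
Context {R : realType} {H : normedModType R[i]}.

Lemma dense_approx (E : set H) (x : H) (e : R[i]) : dense E -> 0 < e ->
  exists2 y, E y & `|x - y| < e.
Proof.
move=> dE e0.
have [||y [/= xy Ey]] := dE (ball x e).
- by exists x; exact: ballxx.
- exact: ball_open.
by exists y => //; rewrite -ball_normE in xy.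
Qed.

Lemma dense_seq (E : set H) (x : H) : dense E ->
  exists2 y : nat -> H, forall n, E (y n) & forall n, `|x - y n| <= n.+1%:R^-1.
Proof.
move=> dE.
have ch n : exists y, E y /\ `|x - y| <= n.+1%:R^-1.
  have [|y Ey /ltW xy] := @dense_approx E x n.+1%:R^-1 dE.
    by rewrite invr_gt0 ltr0n.
  by exists y.
have [y Hy] := choice ch.
by exists y => n; have [] := Hy n.
Qed.

End dense_sets.

(** * Norm estimates for sums of elementary tensors *)

Section positive_tensor.
Context {R : realType} (V : lmodType R[i]) (H : hilbertType R).
Variable k : V -> V -> R[i].
Hypothesis kl : forall a u v w, k (a *: u + v) w = a * k u w + k v w.
Hypothesis kr : forall a u v w, k w (a *: u + v) = Num.conj a * k w u + k w v.
Hypothesis k_ge0 : forall u, 0 <= k u u.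

Let kl0 w : k 0 w = 0.
Proof.
by have := kl (-1) 0 0 w; rewrite scaler0 addr0 mulN1r addNr.
Qed.

Let kr0 w : k w 0 = 0.
Proof.
by have := kr (-1) 0 0 w; rewrite scaler0 addr0 rmorphN1 mulN1r addNr.
Qed.

Let k_lincomb I (r : seq I) (c : I -> R[i]) (u : I -> V) :
  k (\sum_(i <- r) c i *: u i) (\sum_(i <- r) c i *: u i) =
  \sum_(i <- r) \sum_(j <- r) c i * Num.conj (c j) * k (u i) (u j).
Proof.
have kll w : k (\sum_(i <- r) c i *: u i) w = \sum_(i <- r) c i * k (u i) w.
  by elim: r => [|i r IH]; rewrite ?big_nil ?big_cons ?kl0// kl IH.
rewrite kll; apply: eq_bigr => i _.
have -> : k (u i) (\sum_(j <- r) c j *: u j) =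
    \sum_(j <- r) Num.conj (c j) * k (u i) (u j).
  by elim: r {kll} => [|j r IH]; rewrite ?big_nil ?big_cons ?kr0// kr IH.
by rewrite mulr_sumr; apply: eq_bigr => j _; rewrite mulrA.
Qed.

(** The Schur product theorem for the Gram matrices of [k] and of the inner
    product, by induction on the index list: each [v i] is replaced by its
    component [v' i] orthogonal to [v i0].  The components along [v i0]
    contribute a nonnegative multiple of one value [k x x], and [v' i0 = 0]
    removes the index [i0] from what remains. *)
Lemma sum_form_inner_ge0 I (r : seq I) (u : I -> V) (v : I -> H) :
  0 <= \sum_(i <- r) \sum_(j <- r) k (u i) (u j) * '[v i, v j].
Proof.
elim: r v => [|i0 r IH] v; first by rewrite big_nil.
set v0 := v i0; set n := '[v0, v0] : R[i].
(* When [v0 = 0] the division gives [c i = 0], and [v' i0] still vanishes. *)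
pose c i : R[i] := '[v i, v0] / n.
pose v' i := v i - c i *: v0.
have cE i : '[v i, v0] = c i * n.
  rewrite /c; have [n0|n0] := eqVneq n 0; last by rewrite divfK.
  have /eqP : '[v0, v0] == 0 :> R[i] by apply/eqP.
  by move/eqP; rewrite dnorm_eq0 => /eqP v00; rewrite n0 mulr0 v00 linear0r.
have nC : Num.conj n = n by rewrite /n -innerC.
have cE' j : '[v0, v j] = Num.conj (c j) * n by rewrite innerC cE rmorphM/= nC.
have v'0 : v' i0 = 0.
  rewrite /v' /c -/v0; have [n0|n0] := eqVneq n 0; last first.
    by rewrite divff// scale1r subrr.
  have : '[v0, v0] == 0 :> R[i] by apply/eqP.
  by rewrite dnorm_eq0 => /eqP ->; rewrite scaler0 subrr.
have vv' i j : '[v i, v j] = '[v' i, v' j] + n * (c i * Num.conj (c j)) :> R[i].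
  rewrite /v' innerBl !innerBr !innerZl !innerZr cE cE' -/n.
  by ring.
rewrite (_ : \sum_(i <- _) _ =
    \sum_(i <- i0 :: r) \sum_(j <- i0 :: r) k (u i) (u j) * '[v' i, v' j] +
    n * k (\sum_(i <- i0 :: r) c i *: u i) (\sum_(i <- i0 :: r) c i *: u i)).
  rewrite addr_ge0 ?mulr_ge0 ?inner_ge0//.
  rewrite big_cons big1 => [|j _]; last by rewrite v'0 inner0l mulr0.
  rewrite add0r (eq_bigr (fun i => \sum_(j <- r) k (u i) (u j) * '[v' i, v' j]));
    first exact: IH.
  by move=> i _; rewrite big_cons v'0 linear0r mulr0 add0r.
rewrite k_lincomb mulr_sumr -big_split/=; apply: eq_bigr => i _.
rewrite mulr_sumr -big_split/=; apply: eq_bigr => j _.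
by rewrite vv'; ring.
Qed.

End positive_tensor.

Section tensor_bound.
Context {R : realType} {H1 H2 H : hilbertType R} (t : hilbert_tensor H1 H2 H).

Lemma sqr_norm_tens_sum I (r : seq I) (u : I -> H1) (v : I -> H2) :
  `|\sum_(i <- r) t (u i) (v i)| ^+ 2 =
  \sum_(i <- r) \sum_(j <- r) '[u i, u j] * '[v i, v j].
Proof.
rewrite sqr_norm_inner inner_sum; apply: eq_bigr => i _.
by apply: eq_bigr => j _; rewrite inner_tens.
Qed.

End tensor_bound.

Section bound_form.
Context {R : realType} {H K : hilbertType R} (A : bop H) (M : R[i]).
Hypothesis M0 : 0 < M.
Hypothesis AM : forall x, `|A x| <= M * `|x|.

(** Positivity of [M ^+ 2 * '[x, y] - '[A x, A y]], tensored with the inner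
    product of [K]. *)
Lemma sum_bop_inner_le I (r : seq I) (u : I -> H) (v : I -> K) :
  \sum_(i <- r) \sum_(j <- r) '[A (u i), A (u j)] * '[v i, v j] <=
  M ^+ 2 * \sum_(i <- r) \sum_(j <- r) '[u i, u j] * '[v i, v j].
Proof.
pose k (x y : H) : R[i] := M ^+ 2 * '[x, y] - '[A x, A y].
have kl a x y z : k (a *: x + y) z = a * k x z + k y z.
  by rewrite /k linearP !innerDl !innerZl; ring.
have kr a x y z : k z (a *: x + y) = Num.conj a * k z x + k z y.
  by rewrite /k linearP !innerDr !innerZr; ring.
have k0 x : 0 <= k x x.
  rewrite /k subr_ge0 -!sqr_norm_inner -exprMn.
  by rewrite ler_pXn2r// nnegrE ?mulr_ge0// ltW.
rewrite -subr_ge0 mulr_sumr -sumrB.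
rewrite (eq_bigr (fun i => \sum_(j <- r) k (u i) (u j) * '[v i, v j])).
  exact: sum_form_inner_ge0.
move=> i _; rewrite mulr_sumr -sumrB; apply: eq_bigr => j _.
by rewrite /k; ring.
Qed.

End bound_form.

Section tensor_op_bound.
Context {R : realType} {H1 H2 H : hilbertType R} (t : hilbert_tensor H1 H2 H).

Lemma tens_sum_bounded (A : bop H1) (B : bop H2) :
  exists2 M : R[i], 0 < M & forall I (r : seq I) (u : I -> H1) (v : I -> H2),
  `|\sum_(i <- r) t (A (u i)) (B (v i))| <= M * `|\sum_(i <- r) t (u i) (v i)|.
Proof.
have [MA MA0 AM] := bop_norm_le A; have [MB MB0 BM] := bop_norm_le B.
exists (MA * MB) => [|I r u v]; first by rewrite mulr_gt0.
have MAB : 0 <= MA * MB * `|\sum_(i <- r) t (u i) (v i)|.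
  by rewrite mulr_ge0// mulr_ge0// ltW.
rewrite -(@ler_pXn2r _ 2) ?nnegrE//.
rewrite !exprMn !sqr_norm_tens_sum.
apply: (le_trans (sum_bop_inner_le MA0 AM r u (fun i => B (v i)))).
rewrite -mulrA ler_pM2l ?exprn_gt0//.
have := sum_bop_inner_le MB0 BM r v u.
under eq_bigr do under eq_bigr do rewrite mulrC.
by under [X in _ <= _ * X]eq_bigr do under eq_bigr do rewrite mulrC.
Qed.

End tensor_op_bound.

(** * Extension of bounded relations and the operator A (x) B *)

Section bounded_extension.
Context {R : realType}.

(** [R[i]] is only partially ordered; positivity of [e] makes it real, and the
    Archimedean property of [R] applies. *)
Lemma natSinv_lt (e : R[i]) : 0 < e ->
  exists N, forall n, (N <= n)%N -> n.+1%:R^-1 < e.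
Proof.
move=> e0; have er : (complex.Re e)%:C%C = e by rewrite RRe_real ?gtr0_real.
have r0 : 0 < complex.Re e by rewrite -ltcR er.
have [N HN] := ltr_add_invr r0; exists N => n Nn.
rewrite -er -[n.+1%:R](rmorph_nat (real_complex R)) -fmorphV ltcR.
rewrite add0r in HN; apply: le_lt_trans HN.
by rewrite lef_pV2 ?posrE ?ltr0n// ler_nat.
Qed.

Variables (V : normedModType R[i]) (W : completeNormedModType R[i]).
Variables (G : V -> W -> Prop) (M : R[i]).
Hypothesis Glin : forall a x1 y1 x2 y2, G x1 y1 -> G x2 y2 ->
  G (a *: x1 + x2) (a *: y1 + y2).
Hypothesis M0 : 0 < M.
Hypothesis GM : forall x y, G x y -> `|y| <= M * `|x|.
Hypothesis Gdense : dense [set x | exists y, G x y].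

(** The closure of [G] in the product is again linear with the same bound, is
    defined everywhere because [W] is complete, and is single-valued because of
    the bound: it is the graph of the extension. *)
Let cl x y := forall e : R[i], 0 < e ->
  exists x' y', [/\ G x' y', `|x - x'| < e & `|y - y'| < e].

Let cl_lin a x1 y1 x2 y2 : cl x1 y1 -> cl x2 y2 ->
  cl (a *: x1 + x2) (a *: y1 + y2).
Proof.
move=> c1 c2 e e0.
have a1 : 0 < `|a| + 1 by rewrite ltr_pwDr.
have d0 : 0 < e / (`|a| + 1) by rewrite divr_gt0.
have [x1' [y1' [G1 dx1 dy1]]] := c1 _ d0.
have [x2' [y2' [G2 dx2 dy2]]] := c2 _ d0.
exists (a *: x1' + x2'), (a *: y1' + y2'); split; first exact: Glin.
  rewrite opprD addrACA -scalerBr (le_lt_trans (ler_normD _ _))//.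
  rewrite normrZ -(divfK (lt0r_neq0 a1) e) [ltRHS]mulrC mulrDl mul1r.
  by rewrite ler_ltD// ler_wpM2l// ltW.
rewrite opprD addrACA -scalerBr (le_lt_trans (ler_normD _ _))//.
rewrite normrZ -(divfK (lt0r_neq0 a1) e) [ltRHS]mulrC mulrDl mul1r.
by rewrite ler_ltD// ler_wpM2l// ltW.
Qed.

Let cl_bound x y : cl x y -> `|y| <= M * `|x|.
Proof.
move=> c; apply/ler_addgt0Pr => e e0.
have M1 : 0 < 1 + M by rewrite addr_gt0.
have d0 : 0 < e / (1 + M) by rewrite divr_gt0.
have [x' [y' [/GM Gxy /ltW dx /ltW dy]]] := c _ d0.
rewrite -(subrK y' y) (le_trans (ler_normD _ _))//.
have xx' : `|x'| <= e / (1 + M) + `|x|.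
  by rewrite -[x'](subrK x) (le_trans (ler_normD _ _))// lerD2r distrC.
apply: (le_trans (lerD dy (le_trans Gxy (ler_wpM2l (ltW M0) xx')))).
rewrite mulrDr addrA -[X in X + _ + _]mul1r -mulrDl mulrC divfK ?lt0r_neq0//.
by rewrite addrC.
Qed.

Let cl_uniq x y y' : cl x y -> cl x y' -> y = y'.
Proof.
move=> c c'; have := cl_bound (cl_lin (-1) c c').
rewrite !scaleN1r addNr normr0 mulr0 normr_le0 addrC subr_eq0.
by move/eqP.
Qed.

Let cl_total x : exists y, cl x y.
Proof.
have ch n : exists p : V * W, G p.1 p.2 /\ `|x - p.1| < n.+1%:R^-1.
  have [|x' [y Gxy] xx'] := @dense_approx _ _ _ x n.+1%:R^-1 Gdense.
    by rewrite invr_gt0 ltr0n.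
  by exists (x', y).
have [p Hp] := choice ch.
have d n m (e : R[i]) : n.+1%:R^-1 < e -> m.+1%:R^-1 < e ->
    `|(p n).2 - (p m).2| <= M * (e + e).
  move=> en em; have [Gn xn] := Hp n; have [Gm xm] := Hp m.
  have := GM (Glin (-1) Gm Gn); rewrite !scaleN1r ![- _ + _]addrC => /le_trans.
  apply; rewrite ler_wpM2l ?(ltW M0)//.
  rewrite -(subrKA x) (le_trans (ler_normD _ _))// distrC lerD//.
    exact: (ltW (lt_trans xn en)).
  exact: (ltW (lt_trans xm em)).
have : cvgn (fun n => (p n).2 : W).
  apply: cauchy_cvg; apply: cauchy_exP => e e0.
  have M2 : 0 < M * 4 by rewrite mulr_gt0.
  have [N HN] := natSinv_lt (divr_gt0 e0 M2).
  exists (p N).2, N => // n /= Nn.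
  rewrite -ball_normE/=; apply: (le_lt_trans (d N n _ (HN _ _) (HN _ _))) => //.
  rewrite [ltLHS](_ : _ = e / 2); first by rewrite gtr_pMr// invf_lt1// ltr1n.
  have := lt0r_neq0 M0 => Mn0; field.
  by rewrite Mn0.
move=> /cvg_ex[y py]; exists y => e e0.
have /cvgrPdist_lt /(_ e e0) [N1 _ HN1] := py.
have [N2 HN2] := natSinv_lt e0.
have [Gn xn] := Hp (maxn N1 N2).
exists (p (maxn N1 N2)).1, (p (maxn N1 N2)).2; split => //.
  by apply: (lt_trans xn); apply: HN2; exact: leq_maxr.
by apply: HN1 => /=; exact: leq_maxl.
Qed.

Lemma bounded_extension : exists C : {linear V -> W},
  (forall x y, G x y -> C x = y) /\ forall x, `|C x| <= M * `|x|.
Proof.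
have [C HC] := choice cl_total.
have Clin : linear C.
  by move=> a x y; apply: cl_uniq (HC _) (cl_lin _ (HC x) (HC y)).
pose Ca := GRing.isLinear.Build _ _ _ _ C Clin.
pose C' : {linear V -> W} := HB.pack C Ca.
exists C'; split => [x y Gxy|x]; last exact: cl_bound.
apply: (cl_uniq (HC x)) => e e0; exists x, y.
by rewrite !subrr !normr0.
Qed.

End bounded_extension.

Section tensor_operator.
Context {R : realType} {H1 H2 H : hilbertType R} (t : hilbert_tensor H1 H2 H).

(** Elementary tensors may have many expressions as finite sums, so the
    prescription on sums is a relation [G] at first; the norm estimate makes it
    a bounded function. *)
Lemma tensor_opE (A : bop H1) (B : bop H2) (u : H1) (v : H2) :
  tensor_op t A B (t u v) = t (A u) (B v).
Proof.
suff [C HC] : exists C : bop H, forall u v, C (t u v) = t (A u) (B v).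
  exact: (@getPex _ [set C : bop H | forall u v, C (t u v) = t (A u) (B v)]
    (ex_intro _ C HC) u v).
have [M M0 tM] := tens_sum_bounded t A B.
pose G (x y : H) := exists s : seq (H1 * H2),
  x = \sum_(p <- s) t p.1 p.2 /\ y = \sum_(p <- s) t (A p.1) (B p.2).
have Glin a x1 y1 x2 y2 : G x1 y1 -> G x2 y2 ->
    G (a *: x1 + x2) (a *: y1 + y2).
  move=> [s1 [-> ->]] [s2 [-> ->]].
  exists ([seq (a *: p.1, p.2) | p <- s1] ++ s2).
  rewrite !big_cat/= !big_map !scaler_sumr/=; split; congr (_ + _).
    by apply: eq_bigr => p _; rewrite linearZl_LR.
  by apply: eq_bigr => p _; rewrite linearZ linearZl_LR.
have GM x y : G x y -> `|y| <= M * `|x| by move=> [s [-> ->]]; exact: tM.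
have Gd : dense [set x | exists y, G x y].
  move=> O O0 oO; have [x [Ox [n [u' [v' xE]]]]] := dense_tens t O0 oO.
  exists x; split => //; eexists; exists [seq (u' i, v' i) | i <- enum 'I_n].
  split; last reflexivity.
  by rewrite xE big_map/= big_enum.
have [C [CG CM]] := bounded_extension Glin M0 GM Gd.
have Cb : bounded_near C (nbhs (0 : H)).
  apply/linear_boundedP; exists M; split; first exact: gtr0_real.
  move=> r Mr x; apply: (le_trans (CM x)).
  by rewrite ler_wpM2r// ltW.
exists (Bop Cb) => x y /=; apply: CG; exists [:: (x, y)].
by rewrite !big_seq1.
Qed.

End tensor_operator.

(** * Integrals of complex functions *)

Section complex_parts.
Context {R : realType}.
Implicit Types x y : R[i].

Lemma Re_add x y : complex.Re (x + y) = complex.Re x + complex.Re y.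
Proof. by case: x y => [? ?] [? ?]. Qed.

Lemma Im_add x y : complex.Im (x + y) = complex.Im x + complex.Im y.
Proof. by case: x y => [? ?] [? ?]. Qed.

Lemma Re_sub x y : complex.Re (x - y) = complex.Re x - complex.Re y.
Proof. by case: x y => [? ?] [? ?]. Qed.

Lemma Im_sub x y : complex.Im (x - y) = complex.Im x - complex.Im y.
Proof. by case: x y => [? ?] [? ?]. Qed.

Lemma Re_mul x y : complex.Re (x * y) =
  complex.Re x * complex.Re y - complex.Im x * complex.Im y.
Proof. by case: x y => [? ?] [? ?]. Qed.

Lemma Im_mul x y : complex.Im (x * y) =
  complex.Re x * complex.Im y + complex.Im x * complex.Re y.
Proof. by case: x y => [? ?] [? ?]. Qed.

Lemma complex_eqP x y :
  complex.Re x = complex.Re y -> complex.Im x = complex.Im y -> x = y.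
Proof. by case: x y => [? ?] [? ?] /= -> ->. Qed.

Definition sqnorm (x : R[i]) : R := complex.Re x ^+ 2 + complex.Im x ^+ 2.

Lemma sqnorm_ge0 x : 0 <= sqnorm x.
Proof. by rewrite addr_ge0// sqr_ge0. Qed.

Lemma sqnormE x : (sqnorm x)%:C%C = `|x| ^+ 2.
Proof. exact: add_Re2_Im2. Qed.

Lemma norm_Re_le x (r : R) : `|x| <= r%:C%C -> `|complex.Re x| <= r.
Proof. by move=> xr; rewrite -lecR; exact: le_trans (normc_ge_Re x) xr. Qed.

Lemma norm_Im_le x (r : R) : `|x| <= r%:C%C -> `|complex.Im x| <= r.
Proof.
move=> xr; rewrite -lecR; apply: le_trans xr.
by case: x => a b; rewrite normc_def lecR /= -sqrtr_sqr ler_wsqrtr// lerDr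
  sqr_ge0.
Qed.

Lemma normc_le_ReDIm x (r s : R) :
  `|complex.Re x| <= r -> `|complex.Im x| <= s -> `|x| <= (r + s)%:C%C.
Proof.
case: x => a b /= ar bs; rewrite normc_def lecR /=.
have r0 : 0 <= r by apply: le_trans ar.
have s0 : 0 <= s by apply: le_trans bs.
rewrite -[leRHS]ger0_norm ?addr_ge0// -sqrtr_sqr ler_wsqrtr//.
rewrite -(real_normK (num_real a)) -(real_normK (num_real b)).
have := normr_ge0 a; have := normr_ge0 b; nra.
Qed.

End complex_parts.

Section complex_measurability.
Context d (T : measurableType d) (R : realType).

Lemma cmeasurable_fun_sum (D : set T) I (r : seq I) (f : I -> T -> R[i]) :
  (forall i, cmeasurable_fun D (f i)) ->
  cmeasurable_fun D (fun s => \sum_(i <- r) f i s).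
Proof.
move=> mf.
have ReE s : complex.Re (\sum_(i <- r) f i s) = \sum_(i <- r) complex.Re (f i s).
  exact: (big_morph _ Re_add).
have ImE s : complex.Im (\sum_(i <- r) f i s) = \sum_(i <- r) complex.Im (f i s).
  exact: (big_morph _ Im_add).
split.
  by under eq_fun do rewrite ReE; apply: measurable_sum => i; have [] := mf i.
by under eq_fun do rewrite ImE; apply: measurable_sum => i; have [] := mf i.
Qed.

Lemma cmeasurable_funM (D : set T) (f g : T -> R[i]) :
  cmeasurable_fun D f -> cmeasurable_fun D g ->
  cmeasurable_fun D (fun s => f s * g s).
Proof.
move=> [fr fi] [gr gi]; split.
  under eq_fun do rewrite Re_mul.
  by apply: measurable_funB; exact: measurable_funM.
under eq_fun do rewrite Im_mul.
by apply: measurable_funD; exact: measurable_funM.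
Qed.

Lemma cmeasurable_fun_conj (D : set T) (f : T -> R[i]) :
  cmeasurable_fun D f -> cmeasurable_fun D (fun s => Num.conj (f s)).
Proof.
move=> [fr fi].
have cE (z : R[i]) : Num.conj z = (complex.Re z -i* complex.Im z)%C by case: z.
split; first by under eq_fun do rewrite cE /=.
by under eq_fun do rewrite cE /=; exact: measurableT_comp.
Qed.

End complex_measurability.

Section complex_integral.
Context d (T : measurableType d) (R : realType).
Variable mu : {measure set T -> \bar R}.
Implicit Types (f g : T -> R[i]) (a b c : R[i]).

(** Integrability is part of the predicate because [cintegral] has a default
    value on functions that are not integrable. *)
Definition has_cintegral f c :=
  cintegrable mu setT f /\ cintegral mu setT f = c.

Lemma has_cintegral0 : has_cintegral (fun=> 0) 0.
Proof.
split; first by split; exact: integrable0.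
by rewrite /cintegral /= Rintegral_cst// !mul0r.
Qed.

Lemma has_cintegralD f g a b : has_cintegral f a -> has_cintegral g b ->
  has_cintegral (fun s => f s + g s) (a + b).
Proof.
move=> [[fr fi] <-] [[gr gi] <-]; split.
  split.
    rewrite (_ : (fun s => _) = (fun s => (complex.Re (f s))%:E) \+
      (fun s => (complex.Re (g s))%:E))%E; first exact: integrableD.
    by apply/funext => s; rewrite Re_add.
  rewrite (_ : (fun s => _) = (fun s => (complex.Im (f s))%:E) \+
    (fun s => (complex.Im (g s))%:E))%E; first exact: integrableD.
  by apply/funext => s; rewrite Im_add.
apply: complex_eqP; rewrite (Re_add, Im_add) /= -RintegralD//;
  by apply: eq_Rintegral => s _; rewrite (Re_add, Im_add).
Qed.

Lemma has_cintegralB f g a b : has_cintegral f a -> has_cintegral g b ->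
  has_cintegral (fun s => f s - g s) (a - b).
Proof.
move=> [[fr fi] <-] [[gr gi] <-]; split.
  split.
    rewrite (_ : (fun s => _) = (fun s => (complex.Re (f s))%:E) \-
      (fun s => (complex.Re (g s))%:E))%E; first exact: integrableB.
    by apply/funext => s; rewrite Re_sub.
  rewrite (_ : (fun s => _) = (fun s => (complex.Im (f s))%:E) \-
    (fun s => (complex.Im (g s))%:E))%E; first exact: integrableB.
  by apply/funext => s; rewrite Im_sub.
apply: complex_eqP; rewrite (Re_sub, Im_sub) /= -RintegralB//;
  by apply: eq_Rintegral => s _; rewrite (Re_sub, Im_sub).
Qed.

Lemma has_cintegral_sum I (r : seq I) (f : I -> T -> R[i]) (a : I -> R[i]) :
  (forall i, has_cintegral (f i) (a i)) ->
  has_cintegral (fun s => \sum_(i <- r) f i s) (\sum_(i <- r) a i).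
Proof.
move=> fa; elim: r => [|i r IH].
  rewrite big_nil (_ : (fun s => _) = (fun=> 0)); first exact: has_cintegral0.
  by apply/funext => s; rewrite big_nil.
rewrite big_cons (_ : (fun s => _) = (fun s => f i s + \sum_(j <- r) f j s)).
  exact: has_cintegralD.
by apply/funext => s; rewrite big_cons.
Qed.

(** Real and imaginary parts are estimated separately, hence [K + K]. *)
Lemma has_cintegral_le f c (g : T -> R) (K : R) : measurable_fun setT g ->
  has_cintegral f c -> (forall s, `|f s| <= (g s)%:C%C) ->
  (\int[mu]_s (g s)%:E <= K%:E)%E -> `|c| <= (K + K)%:C%C.
Proof.
move=> mg [[fr fi] <-] fg gK.
have bnd (h : T -> R) : mu.-integrable setT (fun s => (h s)%:E) ->
    (forall s, `|h s| <= g s) -> `|\int[mu]_s h s| <= K.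
  move=> ih hg; apply: (le_trans (le_normr_Rintegral _ ih)) => //.
  rewrite -lee_fin fineK; last first.
    apply: integrable_fin_num => //.
    exact: (integrable_norm ih).
  apply: le_trans gK; apply: ge0_le_integral => //=.
  - apply/measurable_EFinP; apply: measurableT_comp => //.
    exact/measurable_EFinP/(measurable_int _ ih).
  - exact/measurable_EFinP.
  - by move=> s _; rewrite lee_fin.
apply: normc_le_ReDIm => /=.
  by apply: bnd => // s; exact: norm_Re_le.
by apply: bnd => // s; exact: norm_Im_le.
Qed.

End complex_integral.

Section product_integral.
Context d1 d2 (T1 : measurableType d1) (T2 : measurableType d2) (R : realType).
Variables (m1 : {sigma_finite_measure set T1 -> \bar R})
  (m2 : {sigma_finite_measure set T2 -> \bar R}).

Lemma integrable_tensor (f : T1 -> R) (g : T2 -> R) :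
  m1.-integrable setT (EFin \o f) -> m2.-integrable setT (EFin \o g) ->
  (m1 \x m2)%E.-integrable setT (fun s => (f s.1 * g s.2)%:E).
Proof.
move=> fi gi.
have mf : measurable_fun setT f by exact/measurable_EFinP/(measurable_int _ fi).
have mg : measurable_fun setT g by exact/measurable_EFinP/(measurable_int _ gi).
apply/integrable12ltyP.
  apply/measurable_EFinP; apply: measurable_funM.
    exact: measurableT_comp mf measurable_fst.
  exact: measurableT_comp mg measurable_snd.
have /integrableP[_ foo] := fi; have /integrableP[_ goo] := gi.
have mag : measurable_fun setT (fun y => `|g y|%:E).
  by apply/measurable_EFinP; exact: measurableT_comp.
have maf : measurable_fun setT (fun x => `|f x|%:E).
  by apply/measurable_EFinP; exact: measurableT_comp.
under eq_integral => x _.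
  under eq_integral => y _ do rewrite /= normrM EFinM.
  rewrite ge0_integralZl//.
  over.
rewrite ge0_integralZr//.
  by rewrite lte_mul_pinfty// ?integral_ge0// ge0_fin_numE// integral_ge0.
exact: integral_ge0.
Qed.

Lemma Rintegral_tensor (f : T1 -> R) (g : T2 -> R) :
  m1.-integrable setT (EFin \o f) -> m2.-integrable setT (EFin \o g) ->
  \int[(m1 \x m2)%E]_s (f s.1 * g s.2) = \int[m1]_s f s * \int[m2]_s g s.
Proof.
move=> fi gi; rewrite {1}/Rintegral -integral12_prod_meas1; last first.
  exact: integrable_tensor.
rewrite /fubini_F.
under eq_integral => x _.
  under eq_integral => y _ do rewrite /= EFinM.
  rewrite integralZl//.
  over.
have gf : (\int[m2]_y (g y)%:E)%E \is a fin_num by exact: integrable_fin_num.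
rewrite -(fineK gf) integralZr// fineM//.
exact: integrable_fin_num.
Qed.

Lemma has_cintegral_tensor (f : T1 -> R[i]) (g : T2 -> R[i]) (a b : R[i]) :
  has_cintegral m1 f a -> has_cintegral m2 g b ->
  has_cintegral (m1 \x m2)%E (fun s => f s.1 * g s.2) (a * b).
Proof.
move=> [[fr fi] <-] [[gr gi] <-].
have irr := integrable_tensor fr gr; have iri := integrable_tensor fr gi.
have iir := integrable_tensor fi gr; have iii := integrable_tensor fi gi.
split.
  split.
    under eq_fun do rewrite Re_mul EFinB.
    exact: integrableB.
  under eq_fun do rewrite Im_mul EFinD.
  exact: integrableD.
apply: complex_eqP; rewrite (Re_mul, Im_mul) /= -!Rintegral_tensor//.
  by rewrite -RintegralB//; apply: eq_Rintegral => s _; rewrite Re_mul.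
by rewrite -RintegralD//; apply: eq_Rintegral => s _; rewrite Im_mul.
Qed.

End product_integral.

(** * Matrix coefficients *)

Section zero_extension.
Context d (T : measurableType d) (R : realType).
Variables (mu : {measure set T -> \bar R}) (D : set T).
Hypothesis mD : measurable D.

(** Coefficients vanish outside the domain of the map, so that integrals and
    measurability can be considered on the whole space, where products and
    limits need no bookkeeping of domains. *)
Lemma restrict_zero (h : T -> R) : (forall s, ~ D s -> h s = 0) -> h \_ D = h.
Proof.
move=> h0; apply/funext => s; rewrite patchE; case: ifPn => // /negP sD.
by rewrite h0// => /mem_set.
Qed.

Lemma integrable_zero_ext (h : T -> R) : (forall s, ~ D s -> h s = 0) ->
  mu.-integrable D (fun s => (h s)%:E) = mu.-integrable setT (fun s => (h s)%:E).
Proof.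
move=> h0.
have hD : (EFin \o h) \_ D = EFin \o h by rewrite restrict_EFin restrict_zero.
apply/idP/idP => [/(integrable_mkcond _ mD)|hi]; first by rewrite hD.
by apply/(integrable_mkcond _ mD); rewrite hD.
Qed.

Lemma Rintegral_zero_ext (h : T -> R) : (forall s, ~ D s -> h s = 0) ->
  \int[mu]_(s in D) h s = \int[mu]_s h s.
Proof. by move=> h0; rewrite Rintegral_mkcond restrict_zero. Qed.

Variable f : T -> R[i].
Hypothesis f0 : forall s, ~ D s -> f s = 0.

Let Re0 s : ~ D s -> complex.Re (f s) = 0. Proof. by move=> /f0 ->. Qed.
Let Im0 s : ~ D s -> complex.Im (f s) = 0. Proof. by move=> /f0 ->. Qed.

Lemma cmeasurable_fun_zero_ext :
  cmeasurable_fun D f <-> cmeasurable_fun setT f.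
Proof.
by rewrite /cmeasurable_fun !(propext (measurable_restrictT _ mD)) !restrict_zero.
Qed.

Lemma has_cintegral_zero_ext c :
  (cintegrable mu D f /\ cintegral mu D f = c) <-> has_cintegral mu f c.
Proof.
rewrite /has_cintegral /cintegrable /cintegral.
by rewrite !integrable_zero_ext// !Rintegral_zero_ext.
Qed.

End zero_extension.

Section coefficients.
Context d (S : measurableType d) (R : realType) (H : hilbertType R).
Variable pi : S -> option (bop H).

Lemma coef_out u v s : ~ domain pi s -> coef pi u v s = 0.
Proof. by rewrite /domain /coef /=; case: (pi s) => // A []. Qed.

Lemma coef2_out u1 v1 u2 v2 s : ~ domain pi s -> coef2 pi u1 v1 u2 v2 s = 0.
Proof. by rewrite /domain /coef2 /=; case: (pi s) => // A []. Qed.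

Lemma coef2E u1 v1 u2 v2 s :
  coef2 pi u1 v1 u2 v2 s = coef pi u1 v1 s * Num.conj (coef pi u2 v2 s).
Proof.
rewrite /coef2 /coef; case: (pi s) => [A|]/=; last by rewrite mul0r.
by rewrite -innerC.
Qed.

Lemma coefBl u u' v s : coef pi (u - u') v s = coef pi u v s - coef pi u' v s.
Proof.
rewrite /coef; case: (pi s) => [A|]/=; last by rewrite subr0.
by rewrite linearB innerBl.
Qed.

Lemma coefBr u v v' s : coef pi u (v - v') s = coef pi u v s - coef pi u v' s.
Proof.
rewrite /coef; case: (pi s) => [A|]/=; last by rewrite subr0.
by rewrite innerBr.
Qed.

Lemma SQP (mu : {measure set S -> \bar R}) : SQ H mu pi <->
  [/\ measurable (domain pi), mu (~` domain pi) = 0%E,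
    forall u v, cmeasurable_fun setT (coef pi u v) &
    forall u1 u2 v1 v2, has_cintegral mu (coef2 pi u1 v1 u2 v2)
      ('[u1, u2] * '[v2, v1])].
Proof.
split=> -[mD D0 mc ic]; split=> //.
- by move=> u v; apply/(cmeasurable_fun_zero_ext mD); [exact: coef_out|exact: mc].
- move=> u1 u2 v1 v2; apply/(has_cintegral_zero_ext _ mD).
    exact: coef2_out.
  exact: ic.
- by move=> u v; apply/(cmeasurable_fun_zero_ext mD); [exact: coef_out|exact: mc].
- move=> u1 u2 v1 v2; apply/(has_cintegral_zero_ext _ mD).
    exact: coef2_out.
  exact: ic.
Qed.

(** An explicit rate turns convergence in [H] into convergence of real
    sequences, through real and imaginary parts. *)
Lemma coef_approx u v s : exists c : R, forall u' v' (n : nat),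
  `|u - u'| <= n.+1%:R^-1 -> `|v - v'| <= n.+1%:R^-1 ->
  `|coef pi u v s - coef pi u' v' s| <= (c * n.+1%:R^-1)%:C%C.
Proof.
rewrite /coef; case: (pi s) => [A|]/=; last first.
  by exists 0 => *; rewrite subrr normr0 mul0r.
have [M M0 AM] := bop_norm_le A.
pose C : R[i] := M * `|v| + M * (`|u| + 1).
have C0 : 0 <= C by rewrite addr_ge0// mulr_ge0// ?addr_ge0// ltW.
exists (complex.Re C) => u' v' n uu' vv'.
have n1 : n.+1%:R^-1 <= 1 :> R[i] by rewrite invf_le1 ?ltr0n// ler1n.
rewrite rmorphM/= RRe_real ?ger0_real// fmorphV rmorph_nat.
have -> : '[A u, v] - '[A u', v'] = '[A (u - u'), v] + '[A u', v - v'] :> R[i].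
  by rewrite linearB innerBl innerBr addrA subrK.
apply: (le_trans (ler_normD _ _)); rewrite mulrDl; apply: lerD.
  apply: (le_trans (inner_le_norm _ _)); rewrite mulrAC ler_wpM2r//.
  by apply: (le_trans (AM _)); rewrite ler_wpM2l// ltW.
apply: (le_trans (inner_le_norm _ _)); apply: ler_pM => //.
apply: (le_trans (AM _)); rewrite ler_wpM2l ?(ltW M0)//.
rewrite -[u'](subrK u) addrC (le_trans (ler_normD _ _))// lerD2l distrC.
exact: le_trans n1.
Qed.

Lemma cvg_of_rate (a : nat -> R) (l c : R) :
  (forall n, `|l - a n| <= c * n.+1%:R^-1) -> a @ \oo --> l.
Proof.
move=> la; have c0 : (fun n => c * harmonic n) @ \oo --> (0 : R).
  by rewrite -(mulr0 c); apply: cvgMl_tmp; exact: cvg_harmonic.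
apply/cvgrPdist_lt => e e0.
move/cvgrPdist_lt: c0 => /(_ e e0); apply: filterS => n.
rewrite sub0r normrN => /(le_lt_trans _); apply.
by apply: (le_trans (la n)); exact: ler_norm.
Qed.

End coefficients.

(** * Passing from a dense set of vectors to all vectors *)

Section additive_functionals.
Context {R : realType} {V : normedModType R[i]}.

(** Additivity makes boundedness on the unit ball a continuity statement: if
    [x - y] has norm at most [1 / n] with [y] in [E], then [g x = g (x - y)] and
    [n * g x = g (n (x - y))] is bounded by [K]. *)
Lemma additive_bounded_dense_eq0 (g : V -> R[i]) (K : R[i]) (E : set V) :
  (forall x y, g (x - y) = g x - g y) ->
  (forall x, `|x| <= 1 -> `|g x| <= K) ->
  dense E -> (forall x, E x -> g x = 0) -> forall x, g x = 0.
Proof.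
move=> gB gK dE gE x.
have g0 : g 0 = 0 by rewrite -(subrr 0) gB subrr.
have gN y : g (- y) = - g y by rewrite -[- y]add0r gB g0 sub0r.
have gD y z : g (y + z) = g y + g z by rewrite -{1}[z]opprK gB gN opprK.
have gMn y n : g (y *+ n) = g y *+ n.
  by elim: n => [|n IH]; rewrite ?mulr0n// !mulrS gD IH.
have K0 : 0 <= K.
  by apply: (le_trans (normr_ge0 (g 0))); apply: gK; rewrite normr0 ler01.
have gxn n : `|g x| * n.+1%:R <= K.
  have [|y Ey xy] := @dense_approx _ _ _ x n.+1%:R^-1 dE.
    by rewrite invr_gt0 ltr0n.
  rewrite mulr_natr -normrMn -gMn -[g _]subr0.
  rewrite -(mul0rn _ n.+1) -(gE y Ey) -gMn -gB -mulrnBl gK//.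
  rewrite normrMn -mulr_natr -ler_pdivlMr ?ltr0n//.
  by rewrite mul1r ltW.
apply/eqP; rewrite -normr_eq0; apply/negPn/negP => gx0.
have gx : 0 < `|g x| by rewrite lt_def gx0 normr_ge0.
have K1 : 0 < K + 1 by rewrite ltr_pwDr.
have [N /(_ N (leqnn N))] := natSinv_lt (divr_gt0 gx K1).
rewrite ltr_pdivlMr// mulrC ltr_pdivrMr ?ltr0n// => /lt_le_trans/(_ (gxn N)).
by rewrite gtrDl ltr10.
Qed.

End additive_functionals.

Section SQ_dense.
Context d (S : measurableType d) (R : realType) (H : hilbertType R).
Variables (mu : {measure set S -> \bar R}) (pi : S -> option (bop H)).
Variable E : set H.
Hypothesis dE : dense E.
Hypothesis mE : forall u v, E u -> E v -> cmeasurable_fun setT (coef pi u v).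

Let coef_cvg u v (x y : nat -> H) s :
  (forall n, `|u - x n| <= n.+1%:R^-1) -> (forall n, `|v - y n| <= n.+1%:R^-1) ->
  (fun n => complex.Re (coef pi (x n) (y n) s)) @ \oo -->
    complex.Re (coef pi u v s) /\
  (fun n => complex.Im (coef pi (x n) (y n) s)) @ \oo -->
    complex.Im (coef pi u v s).
Proof.
move=> ux vy; have [c Hc] := coef_approx pi u v s.
split; apply: (@cvg_of_rate _ _ _ c) => n.
  by rewrite -Re_sub; apply: norm_Re_le; exact: Hc.
by rewrite -Im_sub; apply: norm_Im_le; exact: Hc.
Qed.

Lemma cmeasurable_coef_dense u v : cmeasurable_fun setT (coef pi u v).
Proof.
have [x Ex ux] := dense_seq u dE; have [y Ey vy] := dense_seq v dE.
split.
  apply: (@measurable_fun_cvg _ _ _ _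
    (fun n s => complex.Re (coef pi (x n) (y n) s))) => [n|s _].
    by have [] := mE (Ex n) (Ey n).
  by have [] := coef_cvg s ux vy.
apply: (@measurable_fun_cvg _ _ _ _
  (fun n s => complex.Im (coef pi (x n) (y n) s))) => [n|s _].
  by have [] := mE (Ex n) (Ey n).
by have [] := coef_cvg s ux vy.
Qed.

Hypothesis iE : forall u1 u2 v1 v2, E u1 -> E u2 -> E v1 -> E v2 ->
  has_cintegral mu (coef2 pi u1 v1 u2 v2) ('[u1, u2] * '[v2, v1]).

Lemma measurable_sqnorm_coef u v :
  measurable_fun setT (fun s => sqnorm (coef pi u v s)).
Proof.
have [mr mi] := cmeasurable_coef_dense u v.
by apply: measurable_funD; apply: measurable_funX.
Qed.

(** The additions of [1] leave room for replacing [u] and [v] by any vectors of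
    [E] at distance at most [1]. *)
Let bound (u v : H) : R[i] := (`|u| + 1) ^+ 2 * (`|v| + 1) ^+ 2.

Let bound_ge0 u v : 0 <= bound u v.
Proof. by rewrite mulr_ge0// exprn_ge0// addr_ge0. Qed.

Let integral_sqnorm_E u v : E u -> E v ->
  (\int[mu]_s (sqnorm (coef pi u v s))%:E =
    (complex.Re ('[u, u] * '[v, v]))%:E)%E.
Proof.
move=> Eu Ev; have [[ir _] /(congr1 (@complex.Re R)) /= <-] := iE Eu Eu Ev Ev.
have e s : complex.Re (coef2 pi u v u v s) = sqnorm (coef pi u v s).
  by rewrite coef2E -normCK -sqnormE.
rewrite /Rintegral fineK.
  by apply: eq_integral => s _; rewrite e.
exact: integrable_fin_num.
Qed.

(** Fatou's lemma along sequences of [E], on which the integral is known to be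
    the product of the squared norms. *)
Lemma integral_sqnorm_coef_le u v :
  (\int[mu]_s (sqnorm (coef pi u v s))%:E <= (complex.Re (bound u v))%:E)%E.
Proof.
have [x Ex ux] := dense_seq u dE; have [y Ey vy] := dense_seq v dE.
have near_norm (w z : H) n : `|w - z| <= n.+1%:R^-1 -> `|z| <= `|w| + 1.
  move=> wz; rewrite -[z](subrK w) addrC (le_trans (ler_normD _ _))//.
  rewrite lerD2l distrC (le_trans wz)//.
  by rewrite invf_le1 ?ltr0n// ler1n.
have le_bound n : (\int[mu]_s (sqnorm (coef pi (x n) (y n) s))%:E <=
    (complex.Re (bound u v))%:E)%E.
  rewrite integral_sqnorm_E// lee_fin -lecR.
  rewrite !RRe_real ?ger0_real ?mulr_ge0 ?inner_ge0//.
  rewrite -!sqr_norm_inner ler_pM ?exprn_ge0// ler_pXn2r ?nnegrE ?addr_ge0//.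
    exact: near_norm (ux n).
  exact: near_norm (vy n).
have cvs s : (fun n => (sqnorm (coef pi (x n) (y n) s))%:E) @ \oo -->
    (sqnorm (coef pi u v s))%:E.
  apply: cvg_EFin; first exact: nearW.
  have [cr ci] := coef_cvg s ux vy.
  by apply: cvgD; rewrite expr2; apply: cvgM.
rewrite (eq_integral (fun s => limn_einf
    (fun n => (sqnorm (coef pi (x n) (y n) s))%:E))); last first.
  by move=> s _; rewrite (cvg_limn_einf_sup (cvs s)).
apply: (le_trans (fatou mu _ _ _)) => //.
- by move=> n; apply/measurable_EFinP; exact: measurable_sqnorm_coef.
- by move=> n s _; rewrite lee_fin sqnorm_ge0.
rewrite limn_einf_lim; apply: lime_le; first exact: is_cvg_einfs.
apply: nearW => n; apply: le_trans (le_bound n).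
by apply: ereal_inf_lbound; exists n => /=.
Qed.

(** From [|a b| <= |a|^2 + |b|^2]. *)
Let dominating u1 v1 u2 v2 s :=
  sqnorm (coef pi u1 v1 s) + sqnorm (coef pi u2 v2 s).

Let coef2_le u1 v1 u2 v2 s :
  `|coef2 pi u1 v1 u2 v2 s| <= (dominating u1 v1 u2 v2 s)%:C%C.
Proof.
rewrite coef2E normrM norm_conjC rmorphD/= !sqnormE.
set a := `|_|; set b := `|_|.
have a0 : 0 <= a by exact: normr_ge0.
have b0 : 0 <= b by exact: normr_ge0.
have : 0 <= (a - b) ^+ 2.
  by rewrite -realEsqr rpredB ?ger0_real.
rewrite sqrrB addrAC subr_ge0; apply: le_trans.
by rewrite mulr2n lerDl mulr_ge0.
Qed.

Let dominating_ge0 u1 v1 u2 v2 s : 0 <= dominating u1 v1 u2 v2 s.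
Proof. by rewrite addr_ge0// sqnorm_ge0. Qed.

Let measurable_dominating u1 v1 u2 v2 :
  measurable_fun setT (dominating u1 v1 u2 v2).
Proof. by apply: measurable_funD; exact: measurable_sqnorm_coef. Qed.

Let integral_dominating_le u1 v1 u2 v2 :
  (\int[mu]_s (dominating u1 v1 u2 v2 s)%:E <=
    (complex.Re (bound u1 v1) + complex.Re (bound u2 v2))%:E)%E.
Proof.
rewrite /dominating; under eq_integral do rewrite EFinD.
rewrite ge0_integralD//.
- by rewrite EFinD leeD// integral_sqnorm_coef_le.
- by move=> s _; rewrite lee_fin sqnorm_ge0.
- by apply/measurable_EFinP; exact: measurable_sqnorm_coef.
- by move=> s _; rewrite lee_fin sqnorm_ge0.
- by apply/measurable_EFinP; exact: measurable_sqnorm_coef.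
Qed.

Let cmeasurable_coef2 u1 v1 u2 v2 :
  cmeasurable_fun setT (coef2 pi u1 v1 u2 v2).
Proof.
rewrite (_ : coef2 _ _ _ _ _ = fun s =>
    coef pi u1 v1 s * Num.conj (coef pi u2 v2 s)); last first.
  by apply/funext => s; rewrite coef2E.
apply: cmeasurable_funM; first exact: cmeasurable_coef_dense.
by apply: cmeasurable_fun_conj; exact: cmeasurable_coef_dense.
Qed.

Lemma cintegrable_coef2 u1 v1 u2 v2 :
  cintegrable mu setT (coef2 pi u1 v1 u2 v2).
Proof.
have [mr mi] := cmeasurable_coef2 u1 v1 u2 v2.
have di : mu.-integrable setT (fun s => (dominating u1 v1 u2 v2 s)%:E).
  apply/integrableP; split; first exact/measurable_EFinP.
  under eq_integral do rewrite gee0_abs ?lee_fin ?dominating_ge0//.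
  by apply: (le_lt_trans (integral_dominating_le _ _ _ _)); rewrite ltry.
split; apply: le_integrable di => //; try exact/measurable_EFinP.
  move=> s _ /=; rewrite lee_fin.
  by apply: (le_trans (norm_Re_le (coef2_le _ _ _ _ _))); exact: ler_norm.
move=> s _ /=; rewrite lee_fin.
by apply: (le_trans (norm_Im_le (coef2_le _ _ _ _ _))); exact: ler_norm.
Qed.

Let defect u1 v1 u2 v2 : R[i] :=
  cintegral mu setT (coef2 pi u1 v1 u2 v2) - '[u1, u2] * '[v2, v1].

Let has_coef2 u1 v1 u2 v2 : has_cintegral mu (coef2 pi u1 v1 u2 v2)
  (cintegral mu setT (coef2 pi u1 v1 u2 v2)).
Proof. by split => //; exact: cintegrable_coef2. Qed.

(** The sum of the bound of the integral and of the Cauchy-Schwarz bound, as a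
    function of the four norms. *)
Let major (a b c e : R[i]) : R[i] :=
  2 * ((a + 1) ^+ 2 * (b + 1) ^+ 2 + (c + 1) ^+ 2 * (e + 1) ^+ 2) +
  (a * c) * (e * b).

Let defect_le u1 v1 u2 v2 :
  `|defect u1 v1 u2 v2| <= major `|u1| `|v1| `|u2| `|v2|.
Proof.
apply: (le_trans (ler_normB _ _)); apply: lerD.
  apply: (le_trans (has_cintegral_le (@measurable_dominating u1 v1 u2 v2)
    (has_coef2 _ _ _ _) (coef2_le _ _ _ _) (integral_dominating_le _ _ _ _))).
  rewrite rmorphD/= -mulr2n -[leLHS]mulr_natl rmorphD/=.
  by rewrite !RRe_real ?ger0_real.
by rewrite normrM ler_pM// inner_le_norm.
Qed.

Let major_le a b c e a' b' c' e' : 0 <= a <= a' -> 0 <= b <= b' ->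
  0 <= c <= c' -> 0 <= e <= e' -> major a b c e <= major a' b' c' e'.
Proof.
move=> /andP[a0 aa] /andP[b0 bb] /andP[c0 cc] /andP[e0 ee].
have sq x y : 0 <= x -> x <= y -> (x + 1) ^+ 2 <= (y + 1) ^+ 2 :> R[i].
  move=> x0 xy; rewrite ler_pXn2r ?nnegrE ?addr_ge0 ?lerD2r//.
  exact: le_trans xy.
have sq0 x : 0 <= x -> 0 <= (x + 1) ^+ 2 :> R[i].
  by move=> x0; rewrite exprn_ge0// addr_ge0.
apply: lerD; last by rewrite ler_pM ?mulr_ge0// ler_pM.
by rewrite ler_wpM2l// lerD// ler_pM ?sq0// sq.
Qed.

Let defectE u1 v1 u2 v2 : E u1 -> E v1 -> E u2 -> E v2 -> defect u1 v1 u2 v2 = 0.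
Proof.
move=> Eu1 Ev1 Eu2 Ev2; apply/eqP; rewrite subr_eq0; apply/eqP.
by have [] := iE Eu1 Eu2 Ev1 Ev2.
Qed.

Let cintegralB u1 v1 u2 v2 u1' v1' u2' v2' u1'' v1'' u2'' v2'' :
  (forall s, coef2 pi u1 v1 u2 v2 s =
    coef2 pi u1' v1' u2' v2' s - coef2 pi u1'' v1'' u2'' v2'' s) ->
  cintegral mu setT (coef2 pi u1 v1 u2 v2) =
    cintegral mu setT (coef2 pi u1' v1' u2' v2') -
    cintegral mu setT (coef2 pi u1'' v1'' u2'' v2'').
Proof.
move=> eB; rewrite (_ : coef2 pi u1 v1 u2 v2 = fun s =>
  coef2 pi u1' v1' u2' v2' s - coef2 pi u1'' v1'' u2'' v2'' s);
  last exact/funext.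
by have [] := has_cintegralB (has_coef2 u1' v1' u2' v2')
  (has_coef2 u1'' v1'' u2'' v2'').
Qed.

(** One vector at a time is freed from [E]; monotonicity of [major] gives the
    bound on the unit ball in that vector, the other three being arbitrary. *)
Let defect0 u1 v1 u2 v2 : defect u1 v1 u2 v2 = 0.
Proof.
have n1 (x : H) : `|x| <= 1 -> 0 <= `|x| <= 1 by move=> ->; rewrite normr_ge0.
have nn (x : H) : 0 <= `|x| <= `|x| by rewrite normr_ge0 lexx.
apply: (@additive_bounded_dense_eq0 _ _ (fun x => defect x v1 u2 v2)
  (major 1 `|v1| `|u2| `|v2|) E) => // [x y|x x1|x Ex].
- rewrite /defect (@cintegralB _ _ _ _ x v1 u2 v2 y v1 u2 v2) => [|s].
    by rewrite innerBl; ring.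
  by rewrite !coef2E coefBl; ring.
- by apply: (le_trans (defect_le _ _ _ _)); apply: major_le => //; exact: n1.
apply: (@additive_bounded_dense_eq0 _ _ (fun y => defect x y u2 v2)
  (major `|x| 1 `|u2| `|v2|) E) => // [y z|y y1|y Ey].
- rewrite /defect (@cintegralB _ _ _ _ x y u2 v2 x z u2 v2) => [|s].
    by rewrite innerBr; ring.
  by rewrite !coef2E coefBr; ring.
- by apply: (le_trans (defect_le _ _ _ _)); apply: major_le => //; exact: n1.
apply: (@additive_bounded_dense_eq0 _ _ (fun z => defect x y z v2)
  (major `|x| `|y| 1 `|v2|) E) => // [z w|z z1|z Ez].
- rewrite /defect (@cintegralB _ _ _ _ x y z v2 x y w v2) => [|s].
    by rewrite innerBr; ring.
  by rewrite !coef2E coefBl rmorphB/=; ring.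
- by apply: (le_trans (defect_le _ _ _ _)); apply: major_le => //; exact: n1.
apply: (@additive_bounded_dense_eq0 _ _ (fun w => defect x y z w)
  (major `|x| `|y| `|z| 1) E) => // [w w'|w w1|w Ew].
- rewrite /defect (@cintegralB _ _ _ _ x y z w x y z w') => [|s].
    by rewrite innerBl; ring.
  by rewrite !coef2E coefBr rmorphB/=; ring.
- by apply: (le_trans (defect_le _ _ _ _)); apply: major_le => //; exact: n1.
exact: defectE.
Qed.

Lemma SQ_dense : measurable (domain pi) -> mu (~` domain pi) = 0%E ->
  SQ H mu pi.
Proof.
move=> mD D0; apply/SQP; split => //; first exact: cmeasurable_coef_dense.
move=> u1 u2 v1 v2; split; first exact: cintegrable_coef2.
by apply/eqP; rewrite -subr_eq0; apply/eqP; exact: defect0.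
Qed.

End SQ_dense.

(** * Tensor products *)

Section coefficient_sums.
Context d (S : measurableType d) (R : realType) (H : hilbertType R).
Variable pi : S -> option (bop H).

Lemma coef_sum I J (r : seq I) (q : seq J) (x : I -> H) (y : J -> H) s :
  coef pi (\sum_(i <- r) x i) (\sum_(j <- q) y j) s =
  \sum_(i <- r) \sum_(j <- q) coef pi (x i) (y j) s.
Proof.
rewrite /coef; case: (pi s) => [A|]/=; last first.
  by rewrite big1// => i _; rewrite big1.
by rewrite [A _]linear_sum inner_sum.
Qed.

End coefficient_sums.

(** The order of summation on the right is that of the four vectors in a product
    of two coefficients, while the factors on the left pair the first vector
    with the third and the fourth with the second. *)
Lemma sum_mul_quad (R : comPzRingType) I J K L (r1 : seq I) (r2 : seq J)
    (r3 : seq K) (r4 : seq L) (f : I -> K -> R) (g : L -> J -> R) :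
  (\sum_(i <- r1) \sum_(k <- r3) f i k) * (\sum_(l <- r4) \sum_(j <- r2) g l j) =
  \sum_(i <- r1) \sum_(j <- r2) \sum_(k <- r3) \sum_(l <- r4) f i k * g l j.
Proof.
rewrite mulr_suml; apply: eq_bigr => i _.
rewrite exchange_big/= mulr_sumr; apply: eq_bigr => j _.
by rewrite mulr_suml; apply: eq_bigr => k _; rewrite mulr_sumr.
Qed.

Section tensor_map_theory.
Context {R : realType} {H1 H2 H : hilbertType R} (t : hilbert_tensor H1 H2 H).
Context d1 d2 (S1 : measurableType d1) (S2 : measurableType d2).
Variables (pi1 : S1 -> option (bop H1)) (pi2 : S2 -> option (bop H2)).

Lemma domain_tensor_map :
  domain (tensor_map t pi1 pi2) = domain pi1 `*` domain pi2.
Proof.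
apply/seteqP; split => s; rewrite /domain /tensor_map /=;
  by case: (pi1 s.1) => [A|]; case: (pi2 s.2) => [B|] // [].
Qed.

Lemma coef_tensor_map u1 v1 u2 v2 s :
  coef (tensor_map t pi1 pi2) (t u1 u2) (t v1 v2) s =
  coef pi1 u1 v1 s.1 * coef pi2 u2 v2 s.2.
Proof.
rewrite /coef /tensor_map; case: (pi1 s.1) => [A|]/=; last by rewrite mul0r.
case: (pi2 s.2) => [B|]/=; last by rewrite mulr0.
by rewrite tensor_opE inner_tens.
Qed.

Lemma coef2_tensor_map u1 v1 u2 v2 w1 z1 w2 z2 s :
  coef2 (tensor_map t pi1 pi2) (t u1 u2) (t v1 v2) (t w1 w2) (t z1 z2) s =
  coef2 pi1 u1 v1 w1 z1 s.1 * coef2 pi2 u2 v2 w2 z2 s.2.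
Proof. by rewrite !coef2E !coef_tensor_map rmorphM/=; ring. Qed.

End tensor_map_theory.

Theorem proposition2p9 (R : realType) (H1 H2 H : hilbertType R)
  (t : hilbert_tensor H1 H2 H)
  (d1 d2 : measure_display)
  (S1 : measurableType d1) (S2 : measurableType d2)
  (mu1 : {sigma_finite_measure set S1 -> \bar R})
  (mu2 : {sigma_finite_measure set S2 -> \bar R})
  (pi1 : S1 -> option (bop H1)) (pi2 : S2 -> option (bop H2))
  (hpi1 : SQ H1 mu1 pi1) (hpi2 : SQ H2 mu2 pi2) :
  SQ H (mu1 \x mu2)%E (tensor_map t pi1 pi2).
Proof.
have [mD1 D10 mc1 ic1] := (SQP pi1 mu1).1 hpi1.
have [mD2 D20 mc2 ic2] := (SQP pi2 mu2).1 hpi2.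
apply: (SQ_dense (dense_tens t)).
- move=> _ _ [n [u1 [u2 ->]]] [m [v1 [v2 ->]]].
  rewrite (_ : coef _ _ _ = fun s => \sum_(i < n) \sum_(j < m)
      coef pi1 (u1 i) (v1 j) s.1 * coef pi2 (u2 i) (v2 j) s.2); last first.
    apply/funext => s; rewrite coef_sum; apply: eq_bigr => i _.
    by apply: eq_bigr => j _; rewrite coef_tensor_map.
  apply: cmeasurable_fun_sum => i; apply: cmeasurable_fun_sum => j.
  have [r1 i1] := mc1 (u1 i) (v1 j); have [r2 i2] := mc2 (u2 i) (v2 j).
  apply: cmeasurable_funM; split.
  + exact: measurableT_comp r1 measurable_fst.
  + exact: measurableT_comp i1 measurable_fst.
  + exact: measurableT_comp r2 measurable_snd.
  + exact: measurableT_comp i2 measurable_snd.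
- move=> _ _ _ _ [n1 [u1 [u2 ->]]] [n2 [w1 [w2 ->]]] [m1 [v1 [v2 ->]]]
    [m2 [z1 [z2 ->]]].
  rewrite !inner_sum sum_mul_quad.
  rewrite (_ : coef2 _ _ _ _ _ = fun s => \sum_(i < n1) \sum_(j < m1)
      \sum_(k < n2) \sum_(l < m2)
      coef2 pi1 (u1 i) (v1 j) (w1 k) (z1 l) s.1 *
      coef2 pi2 (u2 i) (v2 j) (w2 k) (z2 l) s.2); last first.
    apply/funext => s; rewrite coef2E !coef_sum.
    rewrite rmorph_sum/= mulr_suml; apply: eq_bigr => i _.
    rewrite mulr_suml; apply: eq_bigr => j _.
    rewrite mulr_sumr; apply: eq_bigr => k _.
    rewrite rmorph_sum/= mulr_sumr; apply: eq_bigr => l _.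
    by rewrite -coef2E coef2_tensor_map.
  do 4 apply: has_cintegral_sum => ?.
  rewrite !inner_tens mulrACA.
  by apply: has_cintegral_tensor; [exact: ic1|exact: ic2].
- by rewrite domain_tensor_map; exact: measurableX.
rewrite domain_tensor_map.
(* The complement of a product lies in the union of two null cylinders. *)
have mC1 := measurableC mD1; have mC2 := measurableC mD2.
apply/negligibleP; first by apply: measurableC; exact: measurableX.
apply: (@negligibleS _ _ _ _
  ((~` domain pi1) `*` setT `|` setT `*` (~` domain pi2))).
  by move=> [x y] /= /not_andP[?|?]; [left|right].
apply: negligibleU; (apply/negligibleP; first exact: measurableX).
  by rewrite -[LHS]/((mu1 \x mu2)%E _) product_measure1E// D10 mul0e.
by rewrite -[LHS]/((mu1 \x mu2)%E _) product_measure1E// D20 mule0.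
Qed.
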